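(* Let $A\in\mathbb{R}^{m\times n}$, $F\in\mathbb{R}^{n\times k}$, $b\in\mathbb{R}^m$, $\mathcal{B}\subseteq\{1,\dots,n\}$, and $\mathcal{X}:=\{x\in\mathbb{R}^n: Ax=b,\ x\ge 0,\ x_j\in\{0,1\}\ \forall j\in\mathcal{B}\}$. Let $\widehat\Xi\subseteq\mathbb{R}_+\times\mathbb{R}^{k-1}$ be a closed, convex, full-dimensional cone and let $\Xi:=\{\xi\in\widehat\Xi:\xi_1=1\}$ be nonempty. Assume: (i) $\mathcal{X}$ is nonempty and bounded; (ii) $Ax=b$, $x\ge0$ imply $0\le x_j\le1$ for all $j\in\mathcal{B}$; (iii) $\Xi$ is convex, closed, and computationally tractable; (iv) $\Xi$ is bounded. Let $\hat\xi_1,\dots,\hat\xi_N\in\Xi$ be $N$ independent samples of a random vector with distribution $\mathbb{P}$ supported on $\Xi$, let $\widehat{\mathbb{P}}_N:=\frac1N\sum_{i=1}^N\delta_{\hat\xi_i}$ be the empirical distribution, let $\epsilon>0$, and let $r>0$ be a scalar such that $\xi^T\xi+x^Tx\le r$ for all $\xi\in\Xi$ and $x\in\mathcal{X}$ (such $r$ exists by (i) and (iv)). Define $v(\xi):=\max\{(F\xi)^Tx:x\in\mathcal{X}\}$ and $$v^+_{\mathcal{D}(\widehat{\mathbb{P}}_N,\epsilon)}:=\sup\Big\{\int_\Xi v(\xi)\,d\mathbb{Q}(\xi)\;:\;\mathbb{Q}\in\mathcal{M}^2(\Xi),\ W^2(\mathbb{Q},\widehat{\mathbb{P}}_N)\le\epsilon\Big\}.$$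 Then $$\begin{array}{lll}v^+_{\mathcal{D}(\widehat{\mathbb{P}}_N,\epsilon)}=&\min & \lambda\epsilon^2+\frac1N\sum_{i=1}^N(\alpha^i+r\rho^i)\\[2pt] &\text{s.t.} & \alpha^i g_1g_1^T-H^i(\lambda)+E^T\mathrm{Diag}(u^i)E+\sum_{j\in\mathcal{B}}v^i_jQ_j+\rho^iI\in\mathcal{COP}(\widehat\Xi\times\mathbb{R}^n_+)\quad\forall i\in\{1,\dots,N\}\\[2pt] && \rho^i\ge0\quad\forall i\in\{1,\dots,N\}\\[2pt] && \lambda\ge0,\end{array}$$ where the minimum is over $\lambda\in\mathbb{R}$ and $\alpha^i,\rho^i\in\mathbb{R}$, $u^i\in\mathbb{R}^m$, $v^i\in\mathbb{R}^{|\mathcal{B}|}$ for $i=1,\dots,N$.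
   Context: $\delta_\zeta$ is the Dirac distribution at $\zeta$, $\|\cdot\|$ is the Euclidean norm, and $\mathbb{S}^d$ is the space of symmetric $d\times d$ real matrices. ''Computationally tractable'' means, for example, that $\Xi$ can be represented using a polynomial number of linear, second-order-cone, and semidefinite inequalities; in particular, $\Xi$ possesses a polynomial-time separation oracle. $\mathcal{M}^2(\Xi)$ is the set of probability distributions $\mathbb{Q}$ supported on $\Xi$ with $\int_\Xi\|\xi-\xi'\|^2d\mathbb{Q}(\xi)<\infty$, where $\xi'\in\Xi$ is some reference point. The 2-Wasserstein distance between $\mathbb{Q},\mathbb{Q}'\in\mathcal{M}^2(\Xi)$ is $$W^2(\mathbb{Q},\mathbb{Q}'):=\inf_\Pi\Big(\int_{\Xi^2}\|\xi-\xi'\|^2\,\Pi(d\xi,d\xi')\Big)^{1/2},$$ the infimum being over joint distributions $\Pi$ of $\xi$ and $\xi'$ with marginals $\mathbb{Q}$ and $\mathbb{Q}'$, respectively. For a closed convex cone $\mathcal{K}\subseteq\mathbb{R}^d$, $\mathcal{COP}(\mathcal{K}):=\{M\in\mathbb{S}^d: z^TMz\ge0\ \forall z\in\mathcal{K}\}$. Let $e_1$ be the first standard basis vector of $\mathbb{R}^k$, $f_j$ the $j$-th standard basis vector of $\mathbb{R}^n$, and $g_1:=\binom{e_1}{0}\in\mathbb{R}^{k+n}$. $\mathrm{Diag}(u)$ is the diagonal matrix with diagonal $u$, and $I$ is the identity matrix of appropriate size. Define $$E:=\begin{pmatrix}-be_1^T & A\end{pmatrix}\in\mathbb{R}^{m\times(k+n)},$$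 $$H^i(\lambda):=\begin{pmatrix}-\lambda\big(I-\hat\xi_ie_1^T-e_1\hat\xi_i^T+\|\hat\xi_i\|^2e_1e_1^T\big) & \frac12F^T\\ \frac12F & 0\end{pmatrix}\in\mathbb{S}^{k+n},$$ $$Q_j:=\binom{0}{f_j}\binom{0}{f_j}^T-\tfrac12\binom{0}{f_j}\binom{e_1}{0}^T-\tfrac12\binom{e_1}{0}\binom{0}{f_j}^T\in\mathbb{S}^{k+n}\quad(j\in\mathcal{B}).$$
   Formalization: The minimum is read as the infimum of the objective over feasible points, since attainment can fail under the stated assumptions (e.g. Ξ={1}, X={1}, A=b=F=1, r=3); the hypothesis that Ξ is computationally tractable is dropped. *)

(* Defs.v *)
From HB Require Import structures.
From mathcomp Require Import all_boot all_order all_algebra.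
From mathcomp Require Import all_classical all_reals all_analysis.

Set Implicit Arguments.
Unset Strict Implicit.
Unset Printing Implicit Defensive.

Import Order.TTheory GRing.Theory Num.Theory.
Import numFieldNormedType.Exports.

Local Open Scope classical_set_scope.
Local Open Scope ring_scope.

(* R^d as column vectors.  The library norm on matrices is the sup norm, so
   the Euclidean norm is defined here; the two induce the same topology (and
   bounded sets), hence [closed], [interior], [bounded_set] are unambiguous. *)
Definition dotv (R : realType) (d : nat) (x y : 'cV[R]_d) : R :=
  (x^T *m y) 0 0.

Definition enorm (R : realType) (d : nat) (x : 'cV[R]_d) : R :=
  Num.sqrt (dotv x x).

Notation borelV R d := (g_sigma_algebraType (@open 'cV[R]_d)).

Definition nonneg_vec (R : realType) (d : nat) (x : 'cV[R]_d) : Prop :=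
  forall j, 0 <= x j 0.

Definition is_cone (R : realType) (d : nat) (K : set 'cV[R]_d) : Prop :=
  forall (t : R) (z : 'cV[R]_d), 0 <= t -> K z -> K (t *: z).

(* for a convex set, nonempty interior means affine hull of dimension d *)
Definition full_dimensional (R : realType) (d : nat) (K : set 'cV[R]_d) :
    Prop :=
  K° !=set0.

Definition COP (R : realType) (d : nat) (K : set 'cV[R]_d) : set 'M[R]_d :=
  [set M | M^T = M /\ forall z, K z -> 0 <= dotv z (M *m z)].

(* only used with Xi closed *)
Definition supported_on (R : realType) (d : nat) (Xi : set 'cV[R]_d)
    (Q : probability (borelV R d) R) : Prop :=
  Q Xi = 1%E.

Definition M2 (R : realType) (d : nat) (Xi : set 'cV[R]_d) :
    set (probability (borelV R d) R) :=
  [set Q | supported_on Xi Q /\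
    exists2 xi' : 'cV[R]_d, Xi xi' &
      (\int[Q]_(xi in Xi) (enorm (xi - xi') ^+ 2)%:E < +oo)%E].

Definition couplings (R : realType) (d : nat)
    (Q Q' : {measure set (borelV R d) -> \bar R}) :
    set (probability (borelV R d * borelV R d)%type R) :=
  [set Pi |
    (forall S : set (borelV R d), measurable S -> Pi (S `*` setT) = Q S) /\
    (forall S : set (borelV R d), measurable S -> Pi (setT `*` S) = Q' S)].

Definition W2 (R : realType) (d : nat) (Xi : set 'cV[R]_d)
    (Q Q' : {measure set (borelV R d) -> \bar R}) : \bar R :=
  ereal_inf
    [set sqrte (\int[Pi]_(z in Xi `*` Xi) (enorm (z.1 - z.2) ^+ 2)%:E)%E
    | Pi in couplings Q Q'].

Definition empirical (R : realType) (d : nat) (N : nat)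
    (x : 'I_N -> borelV R d) (S : set (borelV R d)) : \bar R :=
  ((N%:R^-1)%:E * \sum_(i < N) \d_(x i) S)%E.

Section empirical_measure.
Context (R : realType) (d N : nat) (x : 'I_N -> borelV R d).
Local Open Scope ereal_scope.

Let empirical0 : empirical x set0 = 0.
Proof. by rewrite /empirical big1 ?mule0// => i _; rewrite measure0. Qed.

Let empirical_ge0 S : 0 <= empirical x S.
Proof.
by rewrite mule_ge0 ?lee_fin ?invr_ge0 ?ler0n// sume_ge0// => i _.
Qed.

Let empirical_sigma_additive : semi_sigma_additive (empirical x).
Proof.
move=> F mF tF mUF; rewrite /empirical.
rewrite [X in X @ _ --> _](_ : _ = fun n =>
  (N%:R^-1)%:E * \sum_(i < N) \sum_(0 <= j < n) \d_(x i) (F j)); last first.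
  apply/funext => n; rewrite exchange_big/= ge0_sume_distrr// => j _.
  by rewrite sume_ge0.
apply: cvgeZl => //.
apply: cvg_nnesum => [i _|i _]; first by near=> n; rewrite sume_ge0.
exact: measure_semi_sigma_additive.
Unshelve. all: by end_near. Qed.

HB.instance Definition _ := isMeasure.Build _ _ _ (empirical x)
  empirical0 empirical_ge0 empirical_sigma_additive.

End empirical_measure.

Definition worst_case (R : realType) (d : nat) (Xi : set 'cV[R]_d)
    (f : 'cV[R]_d -> R) (P0 : {measure set (borelV R d) -> \bar R}) (eps : R) :
    \bar R :=
  ereal_sup
    [set (\int[Q]_(xi in Xi) (f xi)%:E)%E
    | Q in [set Q | M2 Xi Q /\ (W2 Xi Q P0 <= eps%:E)%E]].

(* The product rule over all N indices contains the rule for subfamilies,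
   since some of the S i may be taken to be [setT]. *)
Definition mutually_independent (R : realType) (dO : measure_display)
    (Omega : measurableType dO) (Pr : probability Omega R) (d N : nat)
    (X : 'I_N -> {RV Pr >-> borelV R d}) : Prop :=
  forall S : 'I_N -> set (borelV R d), (forall i, measurable (S i)) ->
    Pr (\bigcap_(i in [set: 'I_N]) (X i @^-1` S i)) =
    (\prod_(i < N) Pr (X i @^-1` S i))%E.

Definition relaxation (R : realType) (m n : nat) (A : 'M[R]_(m, n))
    (b : 'cV[R]_m) : set 'cV[R]_n :=
  [set x | A *m x = b /\ nonneg_vec x].

Definition feasible_set (R : realType) (m n : nat) (A : 'M[R]_(m, n))
    (b : 'cV[R]_m) (B : {set 'I_n}) : set 'cV[R]_n :=
  [set x | relaxation A b x /\ forall j, j \in B -> x j 0 = 0 \/ x j 0 = 1].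

(* The dimension of xi is written k.+1, so that its first coordinate is
   [xi 0 0]. *)
Definition slice (R : realType) (k : nat) (Xihat : set 'cV[R]_k.+1) :
    set 'cV[R]_k.+1 :=
  [set xi | Xihat xi /\ xi 0 0 = 1].

(* When X is nonempty and compact this supremum is a maximum. *)
Definition opt_value (R : realType) (k n : nat) (F : 'M[R]_(n, k.+1))
    (X : set 'cV[R]_n) (xi : 'cV[R]_k.+1) : R :=
  sup [set dotv (F *m xi) x | x in X].

Section copositive_program.
Variables (R : realType) (m n k : nat).

Definition e1 : 'cV[R]_k.+1 := delta_mx 0 0.

Definition g1 : 'cV[R]_(k.+1 + n) := col_mx e1 0.

Definition f0 (j : 'I_n) : 'cV[R]_(k.+1 + n) := col_mx 0 (delta_mx j 0).

Definition matE (A : 'M[R]_(m, n)) (b : 'cV[R]_m) : 'M[R]_(m, k.+1 + n) :=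
  row_mx (- (b *m e1^T)) A.

Definition matH (F : 'M[R]_(n, k.+1)) (xih : 'cV[R]_k.+1) (lambda : R) :
    'M[R]_(k.+1 + n) :=
  block_mx
    (- lambda *: (1%:M - xih *m e1^T - e1 *m xih^T
                  + enorm xih ^+ 2 *: (e1 *m e1^T)))
    (2^-1 *: F^T)
    (2^-1 *: F)
    0.

Definition matQ (j : 'I_n) : 'M[R]_(k.+1 + n) :=
  f0 j *m (f0 j)^T - 2^-1 *: (f0 j *m g1^T) - 2^-1 *: (g1 *m (f0 j)^T).

Definition lifted_cone (Xihat : set 'cV[R]_k.+1) : set 'cV[R]_(k.+1 + n) :=
  [set z | Xihat (usubmx z) /\ nonneg_vec (dsubmx z)].

(* v i ranges over R^B, i.e. vectors indexed by the elements of B. *)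
Definition cop_feasible (A : 'M[R]_(m, n)) (b : 'cV[R]_m)
    (F : 'M[R]_(n, k.+1)) (B : {set 'I_n}) (Xihat : set 'cV[R]_k.+1)
    (N : nat) (xih : 'I_N -> 'cV[R]_k.+1)
    (lambda : R) (alpha rho : 'I_N -> R) (u : 'I_N -> 'cV[R]_m)
    (v : 'I_N -> {j | j \in B} -> R) : Prop :=
  [/\ forall i : 'I_N,
        COP (lifted_cone Xihat)
          (alpha i *: (g1 *m g1^T) - matH F (xih i) lambda
           + (matE A b)^T *m diag_mx (u i)^T *m matE A b
           + \sum_(j : {j | j \in B}) v i j *: matQ (val j)
           + rho i *: 1%:M),
      forall i : 'I_N, 0 <= rho i
    & 0 <= lambda].

Definition cop_objective (r eps : R) (N : nat) (lambda : R)
    (alpha rho : 'I_N -> R) : R :=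
  lambda * eps ^+ 2 + N%:R^-1 * \sum_(i < N) (alpha i + r * rho i).

(* The optimal value is the infimum of the objective over the feasible points;
   it need not be attained.  For instance, with k = n = m = N = 1,
   Xihat = R_+, X = {1}, F = 1, no binary variable and r = 3, the optimal value
   is 1, which would force lambda = rho = 0 and alpha = 1; but at z = (1, 1 + t)
   the quadratic form is then u t^2 - t, negative for small t > 0. *)
Definition cop_value (A : 'M[R]_(m, n)) (b : 'cV[R]_m)
    (F : 'M[R]_(n, k.+1)) (B : {set 'I_n}) (Xihat : set 'cV[R]_k.+1)
    (N : nat) (xih : 'I_N -> 'cV[R]_k.+1) (r eps : R) : \bar R :=
  ereal_inf [set y | exists (lambda : R) (alpha rho : 'I_N -> R)
      (u : 'I_N -> 'cV[R]_m) (v : 'I_N -> {j | j \in B} -> R),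
    cop_feasible A b F Xihat xih lambda alpha rho u v /\
    y = (cop_objective r eps lambda alpha rho)%:E].

End copositive_program.

(* Main.v *)
(** The quadratic form of the copositive constraint at [z = (xi, x)] with
    [xi 0 0 = 1], [A x = b] and binary [x_j] equals
    [alpha + lambda |xi - xih|^2 - (F xi).x + rho |z|^2], so a feasible point
    gives [v xi <= alpha + r rho + lambda |xi - xih|^2]; integrating against a
    coupling yields the bound "<=".

    For ">=", mixtures of two selections of points of [Xi] already show that
    the worst case dominates a one-dimensional Lagrangian dual, which provides
    [lambda] and [beta_i >= v xi - lambda |xi - xih_i|^2] on [Xi] of nearly
    optimal cost. With [alpha = beta_i] and [rho > 0] arbitrarily small, the
    form is positive on the unit vectors of the lifted cone with [E z = 0] and
    all [x_j (t - x_j) = 0]. By compactness, a large multiple of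
    [sum_j x_j (t - x_j)], which is nonnegative where [E z = 0], and then a
    much larger multiple of [|E z|^2] make it positive on the whole cone. *)
Require Import Defs.
From HB Require Import structures.
From mathcomp Require Import all_boot all_order all_algebra.
From mathcomp Require Import all_classical all_reals all_analysis.
From mathcomp Require Import measurable_realfun ring lra.

Set Implicit Arguments.
Unset Strict Implicit.
Unset Printing Implicit Defensive.

Import Order.TTheory GRing.Theory Num.Theory.
Import numFieldNormedType.Exports.
Local Open Scope classical_set_scope.
Local Open Scope ring_scope.

(** * Quadratic forms of the copositive program *)

Section dot.
Variable R : realType.
Implicit Types d : nat.

Lemma dotvE d (x y : 'cV[R]_d) : dotv x y = \sum_i x i 0 * y i 0.
Proof. by rewrite /dotv mxE; apply: eq_bigr => i _; rewrite mxE. Qed.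

Lemma dotvC d (x y : 'cV[R]_d) : dotv x y = dotv y x.
Proof. by rewrite !dotvE; apply: eq_bigr => i _; rewrite mulrC. Qed.

Lemma dotvDr d (x y z : 'cV[R]_d) : dotv x (y + z) = dotv x y + dotv x z.
Proof. by rewrite /dotv mulmxDr mxE. Qed.

Lemma dotvZr d a (x y : 'cV[R]_d) : dotv x (a *: y) = a * dotv x y.
Proof. by rewrite /dotv -scalemxAr mxE. Qed.

Lemma dotvNr d (x y : 'cV[R]_d) : dotv x (- y) = - dotv x y.
Proof. by rewrite -scaleN1r dotvZr mulN1r. Qed.

Lemma dotv0r d (x : 'cV[R]_d) : dotv x 0 = 0.
Proof. by rewrite /dotv mulmx0 mxE. Qed.

Lemma dotvDl d (x y z : 'cV[R]_d) : dotv (x + y) z = dotv x z + dotv y z.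
Proof. by rewrite ![dotv _ z]dotvC dotvDr. Qed.

Lemma dotvZl d a (x y : 'cV[R]_d) : dotv (a *: x) y = a * dotv x y.
Proof. by rewrite ![dotv _ y]dotvC dotvZr. Qed.

Lemma dotvNl d (x y : 'cV[R]_d) : dotv (- x) y = - dotv x y.
Proof. by rewrite ![dotv _ y]dotvC dotvNr. Qed.

Lemma dotv_ge0 d (x : 'cV[R]_d) : 0 <= dotv x x.
Proof. by rewrite dotvE sumr_ge0// => i _; rewrite -expr2 sqr_ge0. Qed.

Lemma dotv_eq0 d (x : 'cV[R]_d) : (dotv x x == 0) = (x == 0).
Proof.
apply/eqP/eqP => [|->]; last exact: dotv0r.
rewrite dotvE => /eqP; rewrite psumr_eq0 => [/allP x0|i _]; last first.
  by rewrite -expr2 sqr_ge0.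
apply/colP => i; rewrite mxE; have := x0 i (mem_index_enum i).
by rewrite /= mulf_eq0 orbb => /eqP.
Qed.

Lemma enorm_sqr d (x : 'cV[R]_d) : enorm x ^+ 2 = dotv x x.
Proof. by rewrite sqr_sqrtr// dotv_ge0. Qed.

Lemma coord_sqr_le_dotv d (x : 'cV[R]_d) i : x i 0 ^+ 2 <= dotv x x.
Proof.
rewrite dotvE (bigD1 i)//= -expr2 lerDl sumr_ge0// => j _.
by rewrite -expr2 sqr_ge0.
Qed.

Lemma dotv_col_mx d1 d2 (x x' : 'cV[R]_d1) (y y' : 'cV[R]_d2) :
  dotv (col_mx x y) (col_mx x' y') = dotv x x' + dotv y y'.
Proof. by rewrite /dotv tr_col_mx mul_row_col mxE. Qed.

Lemma dotv_delta d (x : 'cV[R]_d) i : dotv x (delta_mx i 0) = x i 0.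
Proof.
rewrite dotvE (bigD1 i)//= mxE !eqxx mulr1 big1 ?addr0// => j ji.
by rewrite mxE (negbTE ji) mulr0.
Qed.

Lemma dotv_mulmx d1 d2 (x : 'cV[R]_d1) (M : 'M[R]_(d1, d2)) (y : 'cV[R]_d2) :
  dotv x (M *m y) = dotv (M^T *m x) y.
Proof. by rewrite /dotv mulmxA trmx_mul trmxK. Qed.

Lemma dotv_outer d (z u w : 'cV[R]_d) :
  dotv z ((u *m w^T) *m z) = dotv z u * dotv z w.
Proof.
rewrite -mulmxA {1}/dotv mulmxA mxE big_ord_recl big_ord0 addr0.
by rewrite -/(dotv z u) -/(dotv w z) [dotv w z]dotvC.
Qed.

Lemma dotv_gram d1 d2 (E : 'M[R]_(d1, d2)) (u : 'cV[R]_d1) (z : 'cV[R]_d2) :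
  dotv z ((E^T *m diag_mx u^T *m E) *m z) =
  \sum_l u l 0 * (E *m z) l 0 ^+ 2.
Proof.
rewrite -!mulmxA dotv_mulmx trmxK; move: (E *m z) => w.
by rewrite dotvE; apply: eq_bigr => l _; rewrite mul_diag_mx !mxE; ring.
Qed.

Lemma dotv_mulmxZ d (M : 'M[R]_d) t (z : 'cV[R]_d) :
  dotv (t *: z) (M *m (t *: z)) = t ^+ 2 * dotv z (M *m z).
Proof. by rewrite -scalemxAr dotvZl dotvZr mulrA. Qed.

Lemma dotv_mulmx_sum d (I : finType) (M : I -> 'M[R]_d) (z : 'cV[R]_d) :
  dotv z ((\sum_i M i) *m z) = \sum_i dotv z (M i *m z).
Proof.
by rewrite mulmx_suml /dotv mulmx_sumr summxE.
Qed.

Lemma trmx_sum d (I : finType) (M : I -> 'M[R]_d) :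
  (forall i, (M i)^T = M i) -> (\sum_i M i)^T = \sum_i M i.
Proof.
by move=> MT; rewrite raddf_sum; apply: eq_bigr => i _; exact: MT.
Qed.

End dot.

Section cop_matrix.
Variables (R : realType) (m n k : nat).
Variables (A : 'M[R]_(m, n)) (F : 'M[R]_(n, k.+1)) (b : 'cV[R]_m).
Variables (B : {set 'I_n}).

Lemma matQT (j : 'I_n) : (matQ R k j)^T = matQ R k j.
Proof.
rewrite /matQ !linearB/= !linearZ/= !trmx_mul !trmxK.
by rewrite -!addrA; congr (_ + _); rewrite addrC.
Qed.

Lemma matHT (xih : 'cV[R]_k.+1) lambda :
  (matH F xih lambda)^T = matH F xih lambda.
Proof.
rewrite /matH tr_block_mx !linearZ/= trmxK trmx0; congr block_mx; congr (_ *: _).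
rewrite !linearD/= !linearN/= linearZ/= !trmx_mul !trmxK trmx1.
by congr (_ + _); rewrite -!addrA; congr (_ + _); rewrite addrC.
Qed.

(** Homogenized integrality: with first coordinate [t], the value is zero exactly when [x j 0] is
    [0] or [t]. *)
Lemma dotv_matQ (j : 'I_n) (y : 'cV[R]_k.+1) (x : 'cV[R]_n) :
  dotv (col_mx y x) (matQ R k j *m col_mx y x) =
  x j 0 ^+ 2 - y 0 0 * x j 0.
Proof.
rewrite /matQ !mulmxBl -!scalemxAl !dotvDr !dotvNr !dotvZr !dotv_outer.
rewrite /f0 /g1 /e1 !dotv_col_mx !dotv0r !dotv_delta; by field.
Qed.

(** The upper left block is [- lambda] times the Gram matrix of the map sending [y] to
    [y - y 0 0 *: xih], hence the homogenized transport cost from [xih]. The off-diagonal blocks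
    contribute two equal halves of the bilinear objective. *)
Lemma dotv_matH (xih y : 'cV[R]_k.+1) (x : 'cV[R]_n) lambda :
  dotv (col_mx y x) (matH F xih lambda *m col_mx y x) =
  dotv (F *m y) x - lambda * dotv (y - y 0 0 *: xih) (y - y 0 0 *: xih).
Proof.
rewrite /matH mul_block_col mul0mx addr0 dotv_col_mx !dotvDr.
rewrite -!scalemxAl !dotvZr.
rewrite !mulmxDl !mulNmx mul1mx -!scalemxAl !dotvDr !dotvNr !dotvZr.
rewrite !dotv_outer enorm_sqr !dotv_delta !dotvDl !dotvNl !dotvZl.
rewrite dotv_mulmx trmxK [dotv x (F *m y)]dotvC [dotv xih y]dotvC.
by field.
Qed.

(** One constraint of [cop_feasible], isolated so that certificates can be sought sample by sample.
    The body repeats that constraint verbatim, so that it can be folded by conversion. *)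
Definition cop_matrix (xih : 'cV[R]_k.+1) (lambda alpha rho : R)
    (u : 'cV[R]_m) (v : {j | j \in B} -> R) : 'M[R]_(k.+1 + n) :=
  alpha *: (g1 R n k *m (g1 R n k)^T) - matH F xih lambda
  + (matE k A b)^T *m diag_mx u^T *m matE k A b
  + \sum_(j : {j | j \in B}) v j *: matQ R k (val j)
  + rho *: 1%:M.

Lemma cop_matrixT xih lambda alpha rho u v :
  (cop_matrix xih lambda alpha rho u v)^T =
  cop_matrix xih lambda alpha rho u v.
Proof.
rewrite /cop_matrix !linearD/= !linearN/= !linearZ/= !trmx_mul !trmxK matHT.
rewrite tr_diag_mx trmx1 mulmxA trmx_sum// => j.
by rewrite linearZ/= matQT.
Qed.

Lemma matE_mul (y : 'cV[R]_k.+1) (x : 'cV[R]_n) :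
  matE k A b *m col_mx y x = A *m x - y 0 0 *: b.
Proof.
rewrite /matE mul_row_col addrC mulNmx -mulmxA; congr (_ - _).
have -> : (e1 R k)^T *m y = (y 0 0)%:M; last by rewrite mul_mx_scalar.
rewrite [LHS]mx11_scalar; congr (_%:M).
by rewrite -/(dotv (e1 R k) y) dotvC dotv_delta.
Qed.

(** With [t = y 0 0], the vectors [u] and [v] act as multipliers of the homogenized constraints
    [A x = t b] and [x_j (x_j - t) = 0]; their terms disappear at nonnegative multiples of feasible
    points. *)
Lemma dotv_cop_matrix xih lambda alpha rho u v y x :
  dotv (col_mx y x) (cop_matrix xih lambda alpha rho u v *m col_mx y x) =
  alpha * y 0 0 ^+ 2
  + lambda * dotv (y - y 0 0 *: xih) (y - y 0 0 *: xih)
  - dotv (F *m y) x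
  + \sum_l u l 0 * (A *m x - y 0 0 *: b) l 0 ^+ 2
  + \sum_(j : {j | j \in B}) v j * (x (val j) 0 ^+ 2 - y 0 0 * x (val j) 0)
  + rho * (dotv y y + dotv x x).
Proof.
set d := dotv (y - _) _; rewrite /cop_matrix !mulmxDl mulNmx !dotvDr dotvNr dotv_gram dotv_mulmx_sum.
rewrite -!scalemxAl !dotvZr dotv_outer mul1mx !dotv_col_mx dotv_matH -/d.
rewrite dotv0r dotv_delta matE_mul.
under [X in _ + X + _ = _]eq_bigr do rewrite -scalemxAl dotvZr dotv_matQ.
by ring.
Qed.

End cop_matrix.

(** * Topology of column vectors and exact penalties *)

Section topology.
Variable R : realType.

Lemma continuous_mx (T : topologicalType) m n (f : T -> 'M[R]_(m, n)) :
  (forall i j, continuous (fun x => f x i j)) -> continuous f.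
Proof.
move=> cf x; apply/cvg_ballP => e e0.
have : \forall y \near x, forall i j, ball (f x i j) e (f y i j).
  apply: filter_forall => i; apply: filter_forall => j.
  by have /cvg_ballP := cf i j x; apply.
by apply: filterS => y fy; split.
Qed.

Lemma continuous_sum (T : topologicalType) (I : Type) (s : seq I)
    (f : I -> T -> R) :
  (forall i, continuous (f i)) -> continuous (fun x => \sum_(i <- s) f i x).
Proof.
move=> cf; elim: s => [|i s IHs].
  have -> : (fun x => \sum_(i <- [::]) f i x) = cst 0.
    by apply/funext => x; rewrite big_nil.
  by move=> x; exact: cvg_cst.
have -> : (fun x => \sum_(j <- i :: s) f j x) =
    (fun x => f i x + \sum_(j <- s) f j x).
  by apply/funext => x; rewrite big_cons.
by move=> x; apply: cvgD; [exact: cf|exact: IHs].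
Qed.

Lemma continuous_submx (T : topologicalType) m n (M : 'M[R]_(m, n))
    (f : T -> 'M[R]_(m, n)) :
  continuous f -> continuous (fun x => M - f x).
Proof.
move=> cf; apply: continuous_mx => i j.
have -> : (fun x => (M - f x) i j) = (fun x => M i j - f x i j).
  by apply/funext => x; rewrite !mxE.
move=> x; apply: cvgB; first exact: cvg_cst.
by apply: (@continuous_comp _ _ _ f (fun N : 'M[R]_(m, n) => N i j));
  [exact: cf|exact: coord_continuous].
Qed.

Lemma continuous_mulmx (T : topologicalType) m n p (M : 'M[R]_(m, n))
    (f : T -> 'M[R]_(n, p)) :
  continuous f -> continuous (fun x => M *m f x).
Proof.
move=> cf; apply: continuous_mx => i j.
have -> : (fun x => (M *m f x) i j) = (fun x => \sum_l M i l * f x l j).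
  by apply/funext => x; rewrite mxE.
apply: continuous_sum => l x; apply: cvgM; first exact: cvg_cst.
by apply: (@continuous_comp _ _ _ f (fun N : 'M[R]_(n, p) => N l j));
  [exact: cf|exact: coord_continuous].
Qed.

Lemma continuous_dotv (T : topologicalType) n (f g : T -> 'cV[R]_n) :
  continuous f -> continuous g -> continuous (fun x => dotv (f x) (g x)).
Proof.
move=> cf cg.
have -> : (fun x => dotv (f x) (g x)) = (fun x => \sum_i f x i 0 * g x i 0).
  by apply/funext => x; rewrite dotvE.
apply: continuous_sum => i x; apply: cvgM.
  by apply: (@continuous_comp _ _ _ f (fun N : 'cV[R]_n => N i 0));
    [exact: cf|exact: coord_continuous].
by apply: (@continuous_comp _ _ _ g (fun N : 'cV[R]_n => N i 0));
  [exact: cg|exact: coord_continuous].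
Qed.

Lemma continuous_quad n (M : 'M[R]_n) :
  continuous (fun z : 'cV[R]_n => dotv z (M *m z)).
Proof.
apply: continuous_dotv; first by move=> x; exact: cvg_id.
by apply: continuous_mulmx => x; exact: cvg_id.
Qed.

Lemma trmx_continuous m n : continuous (@trmx R m n).
Proof.
apply: continuous_mx => i j.
have -> : (fun x : 'M[R]_(m, n) => x^T i j) = (fun x => x j i).
  by apply/funext => x; rewrite mxE.
exact: coord_continuous.
Qed.

Lemma coord_le_norm m n (M : 'M[R]_(m, n)) i j : `|M i j| <= `|M|.
Proof.
rewrite [leRHS]/Num.norm /= mx_normrE; apply/bigmax_geP; right => /=.
by exists (i, j).
Qed.

Lemma norm_mx_le m n (M : 'M[R]_(m, n)) a :
  0 <= a -> (forall i j, `|M i j| <= a) -> `|M| <= a.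
Proof.
by move=> a0 Ma; rewrite [leLHS]/Num.norm /= mx_normrE; apply/bigmax_leP; split.
Qed.

(** Heine-Borel for row vectors is carried over by transposition, which is continuous and keeps the
    largest absolute entry. *)
Lemma cV_bounded_closed_compact n (C : set 'cV[R]_n) :
  bounded_set C -> closed C -> compact C.
Proof.
move=> [M [Mr CM]] Ccl.
have -> : C = @trmx R 1 n @` [set x | C x^T].
  apply/seteqP; split => [x Cx|_ [x Cx <-]//].
  by exists x^T; rewrite /= trmxK.
apply: continuous_compact.
  by apply: continuous_subspaceT; exact: trmx_continuous.
apply: bounded_closed_compact.
  exists M; split => // a Ma x Cx.
  apply: norm_mx_le => [|i j]; first exact: le_trans (CM _ Ma _ Cx).
  by apply: le_trans (CM _ Ma _ Cx); have := coord_le_norm x^T j i; rewrite mxE.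
apply: preimage_closed Ccl => x _; exact: trmx_continuous.
Qed.

Lemma continuous_closed_ge (T : topologicalType) (f : T -> R) a :
  continuous f -> closed [set x | a <= f x].
Proof.
move=> cf; have := @closed_ge R a; apply: preimage_closed => x _; exact: cf.
Qed.

Lemma continuous_closed_le (T : topologicalType) (f : T -> R) a :
  continuous f -> closed [set x | f x <= a].
Proof.
move=> cf; have := @closed_le R a; apply: preimage_closed => x _; exact: cf.
Qed.

Lemma continuous_closed_eq (T : topologicalType) (f : T -> R) a :
  continuous f -> closed [set x | f x = a].
Proof.
move=> cf; have := @closed_eq R a; apply: preimage_closed => x _; exact: cf.
Qed.

Lemma continuous_penalty (T : topologicalType) (f g : T -> R) (V : R) :
  continuous f -> continuous g -> continuous (fun x => f x + V * g x).
Proof.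
move=> cf cg x; apply: cvgD; first exact: cf.
by apply: cvgM; [exact: cvg_cst|exact: cg].
Qed.

(* On the compact part of [C] where [f <= 0] the penalty [g] is bounded away
   from zero. *)
Lemma compact_exact_penalty (T : topologicalType) (C : set T) (f g : T -> R) :
  compact C -> continuous f -> continuous g ->
  (forall z, C z -> 0 <= g z) ->
  (forall z, C z -> g z = 0 -> 0 < f z) ->
  exists2 V : R, 0 <= V & forall z, C z -> 0 < f z + V * g z.
Proof.
move=> cC cf cg g0 f0; pose D := C `&` [set z | f z <= 0].
have cD : compact D.
  by apply: compact_closedI => //; exact: continuous_closed_le.
have [[z0 Dz0]|D0] := pselect (D !=set0); last first.
  exists 0 => // z Cz; rewrite mul0r addr0 ltNge; apply/negP => fz.
  by apply: D0; exists z.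
have [||c] := @compact_EVT_min T R g D _ cD; first by exists z0.
  exact: continuous_subspaceT.
rewrite inE => -[Cc fc] gmin.
have [||a] := @compact_EVT_min T R f D _ cD; first by exists z0.
  exact: continuous_subspaceT.
rewrite inE => -[Ca fa] fmin.
have gc : 0 < g c.
  rewrite lt_neqAle g0// andbT; apply/eqP => gc0.
  by have := f0 c Cc (esym gc0); rewrite ltNge fc.
(* Here [c] minimizes [g] and [a] minimizes [f] on [D]. On [D] the penalty is then at least
   [1 - f a], so the sum is at least [1]; off [D] the function [f] is already positive. *)
exists ((1 - f a) / g c).
  by rewrite divr_ge0 ?(ltW gc)// subr_ge0 (le_trans fa).
move=> z Cz; have [fz|fz] := leP (f z) 0; last first.
  by rewrite ltr_wpDr// mulr_ge0 ?g0// divr_ge0 ?(ltW gc)// subr_ge0 (le_trans fa).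
have Dz : z \in D by rewrite inE.
have := gmin z Dz; have := fmin z Dz => faz gcz.
have : 1 - f a <= (1 - f a) / g c * g z.
  rewrite -mulrA ler_peMr ?subr_ge0 ?(le_trans fa)//.
  by rewrite mulrC ler_pdivlMr// mul1r.
by lra.
Qed.

End topology.

(** * Existence of copositive certificates *)

Lemma bounded_ray (R : realType) (V : normedModType R) (C : set V) (x y : V) :
  bounded_set C -> (forall s : R, 0 <= s -> C (x + s *: y)) -> y = 0.
Proof.
move=> [M0 [M0r CM0]] Cxy; apply/eqP; apply: contrapT => /negP y0.
have CM z : C z -> `|z| <= M0 + 1 by apply: CM0; rewrite ltrDl.
have y_gt0 : 0 < `|y| by rewrite normr_gt0.
have M_ge0 : 0 <= M0 + 1.
  by apply: le_trans (CM _ (Cxy 0 (lexx 0))); exact: normr_ge0.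
(* With this [s], the displacement [s *: y] has norm [2 * (M0 + 1) + 1], more than the distance
   between two points of norm at most [M0 + 1]. *)
pose s := (2 * (M0 + 1) + 1) / `|y|.
have s_ge0 : 0 <= s by rewrite divr_ge0 ?(ltW y_gt0)//; lra.
have := CM _ (Cxy s s_ge0); have := CM _ (Cxy 0 (lexx 0)).
rewrite scale0r addr0 => xM xyM.
have := ler_normB (x + s *: y) x.
rewrite [x + _]addrC addrK normrZ ger0_norm// /s divfK ?gt_eqF//.
rewrite [_ *: y + x]addrC -/s => h; lra.
Qed.

Section copositive_certificate.
Variables (R : realType) (m n k : nat).
Variables (A : 'M[R]_(m, n)) (F : 'M[R]_(n, k.+1)) (b : 'cV[R]_m).
Variables (B : {set 'I_n}) (Xihat : set 'cV[R]_k.+1).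
Hypothesis Xihat_first : forall xi, Xihat xi -> 0 <= xi 0 0.
Hypothesis Xihat_closed : closed Xihat.
Hypothesis Xihat_convex : convex_set Xihat.
Hypothesis Xihat_cone : is_cone Xihat.
Hypothesis Xi_nonempty : slice Xihat !=set0.
Hypothesis X_nonempty : feasible_set A b B !=set0.
Hypothesis X_bounded : bounded_set (feasible_set A b B).
Hypothesis relax01 : forall x, relaxation A b x ->
  forall j, j \in B -> 0 <= x j 0 <= 1.
Hypothesis Xi_bounded : bounded_set (slice Xihat).

(** Convexity gives the midpoint, and scaling by 2 turns it into the sum. *)
Lemma cone_add x y : Xihat x -> Xihat y -> Xihat (x + y).
Proof.
move=> Kx Ky; have h0 : (0 <= 2^-1 :> R)%R by lra.
have h1 : (2^-1 <= 1 :> R)%R by lra.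
have := Xihat_convex (Itv01 h0 h1) (mem_set Kx) (mem_set Ky).
rewrite inE => /(Xihat_cone (ler0n R 2)); congr (Xihat _).
rewrite /conv/= /convex.conv /= scalerDr !scalerA.
have -> : 2 * 2^-1 = 1 :> R by lra.
have -> : 2 * (1 - 2^-1) = 1 :> R by lra.
by rewrite !scale1r.
Qed.

(** Such a [y] is a recession direction of the slice, which is bounded. *)
Lemma slice_recession y : Xihat y -> y 0 0 = 0 -> y = 0.
Proof.
move=> Ky y0; have [xi [Kxi xi1]] := Xi_nonempty.
apply: (@bounded_ray R _ (slice Xihat) xi) => // s s0; split.
  by apply: cone_add => //; exact: Xihat_cone.
by rewrite !mxE xi1 y0 mulr0 addr0.
Qed.

(** Boundedness is assumed for the binary feasible set only. The bounds on the relaxation first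
    force [x] to vanish on [B]; moving along [x] then preserves integrality and stays inside the
    bounded set. *)
Lemma relaxation_recession x : A *m x = 0 -> nonneg_vec x -> x = 0.
Proof.
move=> Ax0 x_ge0; have [x' [[Ax' x'_ge0] x'B]] := X_nonempty.
have ray s : 0 <= s -> relaxation A b (x' + s *: x).
  move=> s0; split; first by rewrite mulmxDr -scalemxAr Ax0 scaler0 addr0.
  by move=> j; rewrite !mxE addr_ge0// mulr_ge0.
have xB j : j \in B -> x j 0 = 0.
  move=> jB; apply/eqP; rewrite eq_le x_ge0 andbT leNgt; apply/negP => xj0.
  (* This step length raises coordinate [j] by 2, beyond the upper bound 1. *)
  have s0 : 0 <= 2 / x j 0 by rewrite divr_ge0// ltW.
  have := relax01 (ray _ s0) jB; rewrite !mxE divfK ?gt_eqF//.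
  by have := x'_ge0 j; lra.
apply: (@bounded_ray R _ (feasible_set A b B) x') => // s s0; split.
  exact: ray.
by move=> j jB; rewrite !mxE xB// mulr0 addr0; exact: x'B.
Qed.

(** The scale [t] is the first coordinate of [z]. It cannot be zero, since the two recession lemmas
    would then give [z = 0]. *)
Lemma lifted_cone_scaled_slice z : lifted_cone Xihat z ->
  matE k A b *m z = 0 -> z != 0 ->
  exists t xi x, [/\ 0 < t, slice Xihat xi, relaxation A b x &
    z = t *: col_mx xi x].
Proof.
move=> [Ky x_ge0] Ez z_neq0; pose y : 'cV_k.+1 := usubmx z.
pose x : 'cV_n := dsubmx z; pose t := y 0 0.
have zE : z = col_mx y x by rewrite vsubmxK.
have Ax : A *m x = t *: b.
  by move: Ez; rewrite zE matE_mul => /eqP; rewrite subr_eq0 => /eqP.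
have t0 : 0 < t.
  rewrite lt_neqAle Xihat_first// andbT; apply/eqP => t0; move/eqP: z_neq0; apply.
  have y0 : y = 0 by apply: slice_recession; [exact: Ky|exact/esym].
  rewrite zE y0 (@relaxation_recession x) ?col_mx0//.
  by rewrite Ax -t0 scale0r.
exists t, (t^-1 *: y), (t^-1 *: x); split => //.
- split; first by apply: Xihat_cone => //; rewrite invr_ge0 ltW.
  by rewrite mxE mulVf ?gt_eqF.
- split; first by rewrite -scalemxAr Ax scalerA mulVf ?gt_eqF// scale1r.
  by move=> j; rewrite mxE mulr_ge0 ?invr_ge0 ?(ltW t0).
- by rewrite -scale_col_mx scalerA divff ?gt_eqF// scale1r.
Qed.

(** Quadratic forms are homogeneous of degree two, so copositivity only has to be checked on this
    compact set of unit vectors. *)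
Let normalized : set 'cV[R]_(k.+1 + n) :=
  lifted_cone Xihat `&` [set z | dotv z z = 1].

Lemma lifted_cone_closed : closed (lifted_cone Xihat : set 'cV[R]_(k.+1 + n)).
Proof.
apply: closedI.
  apply: preimage_closed Xihat_closed => x _; apply: continuous_mx => i j.
  have -> : (fun z : 'cV[R]_(k.+1 + n) => usubmx z i j) = (fun z => z (lshift n i) j).
    by apply/funext => z; rewrite mxE.
  exact: coord_continuous.
rewrite [X in closed X](_ : _ =
    \bigcap_(j in [set: 'I_n]) [set z : 'cV[R]_(k.+1 + n) | 0 <= z (rshift k.+1 j) 0]).
  apply: closed_bigI => j _; apply: continuous_closed_ge; exact: coord_continuous.
apply/seteqP; split => [z /= z0 j _|z z0 j]; first by have := z0 j; rewrite mxE.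
by rewrite mxE; exact: z0.
Qed.

Lemma compact_normalized : compact normalized.
Proof.
apply: cV_bounded_closed_compact; last first.
  apply: closedI; first exact: lifted_cone_closed.
  apply: continuous_closed_eq; apply: continuous_dotv => x; exact: cvg_id.
exists 1; split => // a a1 z [_ /= z1].
apply: norm_mx_le => [|i j]; first lra.
rewrite (ord1 j); have := coord_sqr_le_dotv z i; rewrite z1.
rewrite -(ler_sqrt (z i 0 ^+ 2))// sqrtr_sqr sqrtr1 => /le_trans; apply.
exact: ltW.
Qed.

Lemma cop_certificate (xih : 'cV[R]_k.+1) (lambda beta rho : R) :
  0 < rho ->
  (forall xi x, slice Xihat xi -> feasible_set A b B x ->
    dotv (F *m xi) x - lambda * dotv (xi - xih) (xi - xih) <= beta) ->
  exists u v, COP (lifted_cone Xihat)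
    (@cop_matrix R m n k A F b B xih lambda beta rho u v).
Proof.
move=> rho0 beta_ub.
pose f z := dotv z (@cop_matrix R m n k A F b B xih lambda beta rho 0 (fun=> 0) *m z).
pose g z := \sum_(j : {j | j \in B}) dotv z (- matQ R k (val j) *m z).
pose h z := dotv (matE k A b *m z) (matE k A b *m z).
have cf : continuous f := @continuous_quad R _ _.
have cg : continuous g.
  by apply: continuous_sum => j; exact: continuous_quad.
have ch : continuous h.
  by apply: continuous_dotv; apply: continuous_mulmx => x; exact: cvg_id.
have h_ge0 z : 0 <= h z by exact: dotv_ge0.
have gE t xi x : slice Xihat xi -> g (t *: col_mx xi x) =
    t ^+ 2 * \sum_(j : {j | j \in B}) (x (val j) 0 - x (val j) 0 ^+ 2).
  move=> [_ xi1]; rewrite /g mulr_sumr; apply: eq_bigr => j _.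
  by rewrite dotv_mulmxZ mulNmx dotvNr dotv_matQ xi1; ring.
have scaled z : normalized z -> h z = 0 ->
    exists t xi x, [/\ 0 < t, slice Xihat xi, relaxation A b x &
    z = t *: col_mx xi x].
  move=> [Kz z1] /eqP; rewrite dotv_eq0 => /eqP Ez.
  apply: lifted_cone_scaled_slice => //; apply/eqP => z0.
  by move: z1; rewrite z0 /= dotv0r => /esym/eqP; rewrite oner_eq0.
have term_ge0 x : relaxation A b x -> forall j : {j | j \in B},
    0 <= x (val j) 0 - x (val j) 0 ^+ 2.
  move=> Rx j; have := relax01 Rx (valP j) => /andP[xj0 xj1].
  by rewrite expr2 -{1}[x _ _]mulr1 -mulrBr mulr_ge0// subr_ge0.
(* First penalty, on the unit vectors with [E z = 0]. These are positive multiples of some [(xi, x)]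
   with [x] in the relaxation, where [g] is nonnegative and vanishes only if [x] is binary on
   [B]. *)
have [|||||V V0 fgV] := @compact_exact_penalty R _ (normalized `&` [set z | h z = 0]) f g.
- apply: compact_closedI; first exact: compact_normalized.
  exact: continuous_closed_eq.
- exact: cf.
- exact: cg.
- move=> z [Cz /= hz]; have [t [xi [x [t0 Sxi Rx ->]]]] := scaled z Cz hz.
  rewrite gE// mulr_ge0 ?sqr_ge0// sumr_ge0// => j _; exact: term_ge0.
- move=> z [Cz /= hz].
  have [t [xi [x [t0 Sxi Rx zE]]]] := scaled z Cz hz.
  rewrite zE gE// => /eqP; rewrite mulf_eq0 sqrf_eq0 gt_eqF//=.
  rewrite psumr_eq0 => [/allP gx0|j _]; last exact: term_ge0.
  have Xx : feasible_set A b B x.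
    split=> // j jB; have := gx0 (exist _ j jB) (mem_index_enum _) => /=.
    rewrite expr2 -{1}[x _ _]mulr1 -mulrBr mulf_eq0 subr_eq0.
    by case/orP => /eqP ->; [left|right].
  (* At [(xi, x)] the form without [u] and [v] is nonnegative by [beta_ub] up to the term in [rho],
     and that term is strictly positive because [z] is a unit vector. *)
  rewrite /f dotv_mulmxZ mulr_gt0 ?exprn_gt0//.
  have xi1 : xi 0 0 = 1 by case: Sxi.
  rewrite dotv_cop_matrix xi1 scale1r expr1n mulr1.
  rewrite big1 => [|l _]; last by rewrite mxE mul0r.
  rewrite big1 => [|j _]; last by rewrite mul0r.
  have := beta_ub xi x Sxi Xx.
  have : 0 < dotv xi xi + dotv x x.
    case: Cz => _ /=; rewrite zE dotvZl dotvZr dotv_col_mx.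
    move=> /eqP; rewrite mulrA -expr2 => /eqP tz.
    have : 0 < t ^+ 2 * (dotv xi xi + dotv x x) by rewrite tz.
    by rewrite pmulr_rgt0 ?exprn_gt0.
  move=> /(mulr_gt0 rho0); lra.
(* Second penalty, on all unit vectors of the cone: where [h] vanishes, [f + V g] is positive by the
   first one. *)
have [|||||U U0 fghU] := @compact_exact_penalty R _ normalized (fun z => f z + V * g z) h.
- exact: compact_normalized.
- exact: continuous_penalty.
- exact: ch.
- by move=> z _; exact: h_ge0.
- by move=> z Cz hz; exact: fgV.
(* A constant [u] turns the Gram term into [U * h]. The sign of [v] is negative because [g] sums the
   forms of [- matQ]. *)
exists (const_mx U), (fun=> - V); split; first exact: cop_matrixT.
move=> z Kz.
have [->|z_neq0] := eqVneq z 0; first by rewrite mulmx0 dotv0r.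
pose s := Num.sqrt (dotv z z).
have s0 : 0 < s by rewrite sqrtr_gt0 lt_neqAle eq_sym dotv_eq0 z_neq0 dotv_ge0.
have Cz : normalized (s^-1 *: z).
  split; last first.
    rewrite /= dotvZl dotvZr mulrA -expr2 exprVn sqr_sqrtr ?dotv_ge0//.
    by rewrite mulVf// dotv_eq0.
  have s'0 : 0 <= s^-1 by rewrite invr_ge0 ltW.
  case: Kz => Ky x_ge0; split; first by rewrite linearZ/=; exact: Xihat_cone.
  by move=> j; rewrite linearZ/= mxE mulr_ge0.
have -> : z = s *: (s^-1 *: z) by rewrite scalerA divff ?gt_eqF// scale1r.
rewrite dotv_mulmxZ mulr_ge0 ?sqr_ge0//.
have := fghU _ Cz => /ltW; move: (s^-1 *: z) => w.
rewrite /f /g /h -[w]vsubmxK; move: (usubmx w) (dsubmx w) => y x.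
rewrite !dotv_cop_matrix matE_mul.
have -> : dotv (A *m x - y 0 0 *: b) (A *m x - y 0 0 *: b) =
    \sum_l (A *m x - y 0 0 *: b) l 0 ^+ 2.
  by rewrite dotvE; apply: eq_bigr => l _; rewrite expr2.
move: (A *m x - y 0 0 *: b) => w'; move/le_trans; apply.
have -> : \sum_l (0 : 'cV[R]_m) l 0 * w' l 0 ^+ 2 = 0.
  by apply: big1 => l _; rewrite mxE mul0r.
have -> : \sum_l (const_mx U : 'cV[R]_m) l 0 * w' l 0 ^+ 2 = U * \sum_l w' l 0 ^+ 2.
  by rewrite mulr_sumr; apply: eq_bigr => l _; rewrite mxE.
have -> : \sum_(j : {j | j \in B}) 0 * (x (val j) 0 ^+ 2 - y 0 0 * x (val j) 0) = 0.
  by apply: big1 => j _; rewrite mul0r.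
have -> : \sum_(j : {j | j \in B})
      dotv (col_mx y x) (- matQ R k (val j) *m col_mx y x) =
    - \sum_(j : {j | j \in B}) (x (val j) 0 ^+ 2 - y 0 0 * x (val j) 0).
  by rewrite -sumrN; apply: eq_bigr => j _; rewrite mulNmx dotvNr dotv_matQ.
rewrite -mulr_sumr le_eqVlt; apply/orP; left; apply/eqP; ring.
Qed.

End copositive_certificate.

(** * Borel measurability and discrete mixtures *)

Section borel.
Variable R : realType.

(** The open upper rays generate the Borel sets of the line, and lower semicontinuity makes their
    preimages open. *)
Lemma lsc_measurable n (f : 'cV[R]_n -> R) :
  (forall a, open [set z | a < f z]) ->
  measurable_fun setT (f : borelV R n -> R).
Proof.
move=> of_; apply: (measurability _ (RGenOInfty.measurableE R)).
move=> /= _ [_ [a ->]] <-; apply: measurableI => //.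
apply: sub_sigma_algebra; rewrite preimage_itvoy; exact: of_.
Qed.

Lemma continuous_measurable_cV n (f : 'cV[R]_n -> R) :
  continuous f -> measurable_fun setT (f : borelV R n -> R).
Proof.
move=> cf; apply: lsc_measurable => a.
have := @open_gt R a; apply: open_comp => x _; exact: cf.
Qed.

(** The supremum exceeds [a] exactly when some member does, which gives a union of open sets. The
    family may be uncountable, so measurability of such suprema is obtained through openness. *)
Lemma open_sup_gt (T : topologicalType) (I : Type) (D : set I)
    (h : I -> T -> R) :
  D !=set0 -> (forall i, continuous (h i)) ->
  (forall z, has_ubound [set h i z | i in D]) ->
  forall a, open [set z | a < sup [set h i z | i in D]].
Proof.
move=> [i0 Di0] ch hub a.
rewrite (_ : [set z | _] = \bigcup_(i in D) [set z | a < h i z]).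
  apply: bigcup_open => i _; have := @open_gt R a; apply: open_comp => x _.
  exact: ch.
apply/seteqP; split => [z /= asup|z [i Di /= ai]]; last first.
  by apply: (lt_le_trans ai); apply: ub_le_sup => //; exists i.
apply: contrapT => nz; move: asup; apply/negP; rewrite -leNgt.
apply: ge_sup; first by exists (h i0 z), i0.
move=> _ [i Di <-]; rewrite leNgt; apply/negP => ai; apply: nz.
by exists i.
Qed.

(** The pair space carries the product of the two Borel sigma-algebras, so the distance is expanded
    into coordinates, each measurable through a projection. *)
Lemma measurable_sqdist n :
  measurable_fun setT (fun z : borelV R n * borelV R n => enorm (z.1 - z.2 : 'cV[R]_n) ^+ 2).
Proof.
have -> : (fun z : borelV R n * borelV R n => enorm (z.1 - z.2 : 'cV[R]_n) ^+ 2) =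
    (fun z => \sum_i ((z.1 : 'cV[R]_n) i 0 - (z.2 : 'cV[R]_n) i 0) ^+ 2).
  apply/funext => z; rewrite enorm_sqr dotvE; apply: eq_bigr => i _.
  by rewrite !mxE expr2.
apply: measurable_sum => i; apply: measurable_funX; apply: measurable_funB.
  have /continuous_measurable_cV mi : continuous (fun x : 'cV[R]_n => x i 0).
    exact: coord_continuous.
  exact: (measurableT_comp mi measurable_fst).
have /continuous_measurable_cV mi : continuous (fun x : 'cV[R]_n => x i 0).
  exact: coord_continuous.
exact: (measurableT_comp mi measurable_snd).
Qed.

End borel.

Section discrete.
Context d (T : measurableType d) (R : realType).

(** The values on sets serve to identify marginals, the integrals to compute costs and gains. The
    space is arbitrary because the lemma is applied both to points and to pairs of points. *)
Lemma mixture_exists N (x x' : 'I_N -> T) (t : R) : (0 < N)%N -> 0 <= t <= 1 ->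
  exists mu : probability T R,
    (forall S, mu S = (N%:R^-1)%:E *
       \sum_(i < N) ((1 - t)%:E * \d_(x i) S + t%:E * \d_(x' i) S))%E /\
    (forall D (f : T -> R), measurable D ->
      (forall i, D (x i)) -> (forall i, D (x' i)) ->
      measurable_fun D f -> (forall z, D z -> 0 <= f z) ->
      (\int[mu]_(z in D) (f z)%:E =
      (N%:R^-1 * \sum_(i < N) ((1 - t) * f (x i) + t * f (x' i)))%:E)%E).
Proof.
case: N x x' => // N x x' _ /andP[t0 t1].
have a0 : 0 <= N.+1%:R^-1 * (1 - t) by rewrite mulr_ge0 ?invr_ge0// subr_ge0.
have b0 : 0 <= N.+1%:R^-1 * t by rewrite mulr_ge0 ?invr_ge0.
(* [msum] takes a sequence indexed by natural numbers; [inord] recovers the index and is exact below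
   [N.+1]. *)
pose m_ (j : nat) := measure_add (mscale (NngNum a0) (dirac (x (inord j))))
  (mscale (NngNum b0) (dirac (x' (inord j)))).
pose mu := msum m_ N.+1.
have muE S : mu S = ((N.+1%:R^-1)%:E *
       \sum_(i < N.+1) ((1 - t)%:E * \d_(x i) S + t%:E * \d_(x' i) S))%E.
  rewrite ge0_sume_distrr => [|i _]; last first.
    by rewrite adde_ge0// mule_ge0// lee_fin ?subr_ge0.
  rewrite /mu /msum; apply: eq_bigr => i _; rewrite [LHS]measure_addE /mscale/=.
  rewrite inord_val ge0_muleDr ?mule_ge0 ?lee_fin ?subr_ge0//.
  by rewrite !muleA -!EFinM.
have mu1 : mu setT = 1%E.
  rewrite muE.
  under eq_bigr do rewrite !diracT !mule1 -EFinD subrK.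
  by rewrite sumEFin sumr_const card_ord -EFinM mulVf.
pose P : probability T R := HB.pack mu (Measure_isProbability.Build _ _ _ mu mu1).
exists P; split; first exact: muE.
move=> D f mD Dx Dx' mf f0.
have mf' : measurable_fun D (EFin \o f) by exact/measurable_EFinP.
have f0' z : D z -> (0 <= (EFin \o f) z)%E by move=> Dz; rewrite lee_fin f0.
rewrite -[LHS]/(\int[msum m_ N.+1]_(z in D) (EFin \o f) z)%E.
rewrite ge0_integral_measure_sum// mulr_sumr -sumEFin; apply: eq_bigr => i _.
rewrite ge0_integral_measure_add// !ge0_integral_mscale// !integral_dirac//.
rewrite !diracE !inord_val !mem_set// !mul1e/= -!EFinM -EFinD.
by congr (_%:E); ring.
Qed.

End discrete.

(** * Duality for the Wasserstein ball *)

(* [lambda] is the largest slope of the chords issued from [(e, W)]; convexity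
   of the mixtures bounds it by the slopes on the other side of [e]. *)
Lemma lagrange_multiplier (R : realType) (T : Type) (c w : T -> R) (e W : R)
    (x0 : T) : c x0 < e ->
  (forall x x' t, 0 <= t <= 1 -> (1 - t) * c x + t * c x' <= e ->
    (1 - t) * w x + t * w x' <= W) ->
  exists2 lambda, 0 <= lambda & forall x, w x - lambda * (c x - e) <= W.
Proof.
move=> cx0 mix.
(* Including [0] makes [S] nonempty and its supremum nonnegative. *)
pose S := [set s | s = 0 \/ exists2 x, e < c x & s = (w x - W) / (c x - e)].
have wW x : c x <= e -> w x <= W.
  move=> cx; have := mix x x 0; rewrite subr0 !mul1r !mul0r !addr0; apply=> //.
  by rewrite lexx ler01.
have S_ub x : c x < e -> ubound S ((W - w x) / (e - c x)).
  move=> cx s [->|[y cy ->]].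
    by rewrite divr_ge0// subr_ge0 ?wW// ltW.
  have d0 : 0 < c y - c x by lra.
  have ey : 0 < c y - e by lra.
  have ex : 0 < e - c x by lra.
  (* The weight is the one for which the mixture of [y] and [x] costs exactly [e]. *)
  have := mix y x ((c y - e) / (c y - c x)).
  have -> : 1 - (c y - e) / (c y - c x) = (e - c x) / (c y - c x).
    by field; rewrite gt_eqF.
  rewrite divr_ge0 ?(ltW ey) ?(ltW d0)//= ler_pdivrMr// mul1r.
  have -> : (e - c x) / (c y - c x) * c y + (c y - e) / (c y - c x) * c x = e.
    by field; rewrite gt_eqF.
  have -> : (e - c x) / (c y - c x) * w y + (c y - e) / (c y - c x) * w x =
      ((e - c x) * w y + (c y - e) * w x) / (c y - c x).
    by field; rewrite gt_eqF.
  rewrite ler_pdivrMr// => /(_ _ (lexx _)) h.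
  rewrite ler_pdivrMr// mulrAC ler_pdivlMr//.
  have : c y - e <= c y - c x by lra.
  by move/h; lra.
have hub : has_ubound S by exists ((W - w x0) / (e - c x0)); exact: S_ub.
exists (sup S); first by apply: ub_le_sup => //; left.
move=> x; have [cx|cx|cx] := ltgtP (c x) e.
- have : sup S <= (W - w x) / (e - c x).
    by apply: ge_sup; [exists 0; left|exact: S_ub].
  by rewrite ler_pdivlMr ?subr_gt0//; lra.
- have : (w x - W) / (c x - e) <= sup S.
    by apply: ub_le_sup => //; right; exists x.
  by rewrite ler_pdivrMr ?subr_gt0//; lra.
- by rewrite cx subrr mulr0 subr0 wW// cx.
Qed.

Section wasserstein_duality.
Variables (R : realType) (d N : nat) (Xi : set 'cV[R]_d).
Variables (f : 'cV[R]_d -> R) (xih : 'I_N -> 'cV[R]_d) (M eps : R).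
Hypothesis N_gt0 : (0 < N)%N.
Hypothesis Xi_closed : closed Xi.
Hypothesis f_lsc : forall a, open [set z | a < f z].
Hypothesis f_bound : forall xi, Xi xi -> `|f xi| <= M.
Hypothesis xih_in : forall i, Xi (xih i).
Hypothesis eps_gt0 : 0 < eps.

Let P0 : {measure set (borelV R d) -> \bar R} :=
  empirical (xih : 'I_N -> borelV R d).

Lemma measurable_closed_borelV : measurable (Xi : set (borelV R d)).
Proof.
rewrite -[Xi]setCK; apply: measurableC; apply: sub_sigma_algebra.
exact: closed_openC.
Qed.

Let mXi := measurable_closed_borelV.

Let mf : measurable_fun (Xi : set (borelV R d)) (f : borelV R d -> R).
Proof. by apply: measurable_funTS; exact: lsc_measurable. Qed.

Let M_ge0 : 0 <= M.
Proof. by apply: le_trans (f_bound (xih_in (Ordinal N_gt0))). Qed.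

(** Adding [M] makes the integrand nonnegative on [Xi], so that the integration rules for
    nonnegative functions apply; this identity undoes the shift. *)
Lemma integral_shift (Q : probability (borelV R d) R) : Q Xi = 1%E ->
  (\int[Q]_(xi in Xi) (f xi + M)%:E = \int[Q]_(xi in Xi) (f xi)%:E + M%:E)%E.
Proof.
move=> Q1; under eq_integral do rewrite EFinD.
rewrite integralD//=.
- by rewrite (integral_cst Q mXi M%:E) [X in (_ * X)%E](_ : _ = 1%E) ?mule1.
- apply: measurable_bounded_integrable => //=; first by rewrite Q1 ltry.
  exists M; split; first by rewrite num_real.
  by move=> a Ma x Xx; apply: le_trans (f_bound Xx) (ltW Ma).
- apply: measurable_bounded_integrable => //=; first by rewrite Q1 ltry.
  exists M; split; first by rewrite num_real.
  by move=> a Ma x Xx; rewrite ger0_norm// ltW.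
Qed.

Lemma integral_shift_fin (Q : probability (borelV R d) R) : Q Xi = 1%E ->
  (\int[Q]_(xi in Xi) (f xi)%:E)%E \is a fin_num.
Proof.
move=> Q1; apply: integrable_fin_num => //.
apply: measurable_bounded_integrable => //=; first by rewrite Q1 ltry.
exists M; split; first by rewrite num_real.
by move=> a Ma x Xx; apply: le_trans (f_bound Xx) (ltW Ma).
Qed.

(** The empirical measure is the mixture with [t = 0]. *)
Lemma empirical_integral (g : 'cV[R]_d -> R) :
  measurable_fun (Xi : set (borelV R d)) (g : borelV R d -> R) ->
  (forall xi, Xi xi -> 0 <= g xi) ->
  (\int[P0]_(xi in Xi) (g xi)%:E = (N%:R^-1 * \sum_(i < N) g (xih i))%:E)%E.
Proof.
move=> mg g0.
have t01 : 0 <= (0 : R) <= 1 by rewrite lexx ler01.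
have [mu [muE muI]] := mixture_exists (xih : 'I_N -> borelV R d) xih N_gt0 t01.
rewrite (eq_measure_integral mu) => [|S mS _]; last first.
  apply: etrans (esym (muE S)); congr (_ * _)%E; apply: eq_bigr => i _.
  by rewrite subr0 mul1e mul0e adde0.
rewrite muI//; congr (EFin (_ * _)); apply: eq_bigr => i _.
by rewrite subr0 mul1r mul0r addr0.
Qed.

(** The Lagrangian integrand: the value at [xi], less the price [lambda] per unit of cost for moving
    mass from [zeta] to [xi]. *)
Let gain (lambda : R) (xi zeta : 'cV[R]_d) : R :=
  f xi - lambda * dotv (xi - zeta) (xi - zeta).

Lemma continuous_gain lambda xi : continuous (gain lambda xi).
Proof.
have cz : continuous (fun z : 'cV[R]_d => xi - z).
  by apply: continuous_submx => z; exact: cvg_id.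
rewrite (_ : gain lambda xi = fun z => f xi + (- lambda) * dotv (xi - z) (xi - z)).
  by apply: continuous_penalty; [exact: cst_continuous|exact: continuous_dotv].
by apply/funext => z; rewrite mulNr.
Qed.

Lemma gain_has_ubound lambda zeta : 0 <= lambda ->
  has_ubound [set gain lambda xi zeta | xi in Xi].
Proof.
move=> lambda_ge0; exists M => _ [xi Xxi <-]; rewrite /gain.
apply: le_trans (le_trans (ler_norm _) (f_bound Xxi)).
by rewrite lerBlDr lerDl mulr_ge0// dotv_ge0.
Qed.

(* [g] is the sup-convolution of [f] over [Xi]. As a supremum of continuous
   functions it is lower semicontinuous, hence Borel, and as a function of the
   point rather than of the index it is well defined for repeated samples. *)
Section weak.
Variables (lambda : R) (beta : 'I_N -> R).
Hypothesis lambda_ge0 : 0 <= lambda.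
Hypothesis beta_ub : forall i xi, Xi xi -> gain lambda xi (xih i) <= beta i.

Let g (zeta : 'cV[R]_d) : R := sup [set gain lambda xi zeta | xi in Xi].

Let gainE_le xi zeta : Xi xi ->
  f xi <= g zeta + lambda * enorm (xi - zeta) ^+ 2.
Proof.
by move=> Xxi; rewrite enorm_sqr -lerBlDr; apply: ub_le_sup; [exact: gain_has_ubound|exists xi].
Qed.

Let g_ge zeta : Xi zeta -> - M <= g zeta.
Proof.
move=> Xz; have := gainE_le zeta Xz; rewrite subrr enorm_sqr dotv0r mulr0 addr0.
by apply: le_trans; have := f_bound Xz; rewrite ler_norml => /andP[].
Qed.

Let mg : measurable_fun setT (g : borelV R d -> R).
Proof.
apply: lsc_measurable => a; apply: open_sup_gt => //.
- by exists (xih (Ordinal N_gt0)).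
- by move=> xi; exact: continuous_gain.
- by move=> z; exact: gain_has_ubound.
Qed.

Let avg_g : N%:R^-1 * \sum_(i < N) (g (xih i) + M) <=
  N%:R^-1 * \sum_(i < N) beta i + M.
Proof.
rewrite big_split/= sumr_const card_ord mulrDr lerD//.
  rewrite ler_wpM2l ?invr_ge0// ler_sum// => i _; apply: ge_sup.
    by exists (gain lambda (xih i) (xih i)), (xih i).
  by move=> _ [xi Xxi <-]; exact: beta_ub.
by rewrite -[M *+ N]mulr_natl mulKf// pnatr_eq0 -lt0n.
Qed.

(** Weak duality for one coupling: the pointwise bound of [f] at the first point by [g] at the
    second plus [lambda] times the cost is integrated, after the shift by [M], and the marginals
    evaluate both sides. *)
Let coupling_bound (Q : probability (borelV R d) R) Pi :
  Q Xi = 1%E -> couplings Q P0 Pi ->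
  (\int[Q]_(xi in Xi) (f xi)%:E <= (N%:R^-1 * \sum_(i < N) beta i)%:E +
    lambda%:E * \int[Pi]_(z in Xi `*` Xi) (enorm (z.1 - z.2) ^+ 2)%:E)%E.
Proof.
move=> Q1 [Pi1 Pi2].
have f0 xi : Xi xi -> 0 <= f xi + M.
  by move=> Xxi; have := f_bound Xxi; rewrite ler_norml => /andP[]; lra.
have g0 xi : Xi xi -> 0 <= g xi + M.
  by move=> Xxi; have := g_ge Xxi; lra.
have mfM : measurable_fun (Xi : set (borelV R d)) (fun xi : borelV R d => (f xi + M)%:E).
  by apply/measurable_EFinP; exact: measurable_funD.
have mgM : measurable_fun setT (fun xi : borelV R d => (g xi + M)%:E).
  by apply/measurable_EFinP; exact: measurable_funD.
have mXX : measurable (Xi `*` Xi : set (borelV R d * borelV R d)).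
  exact: measurableX.
have mXT : measurable (Xi `*` setT : set (borelV R d * borelV R d)).
  exact: measurableX.
have mTX : measurable (setT `*` Xi : set (borelV R d * borelV R d)).
  exact: measurableX.
have mTCX : measurable (setT `*` ~` Xi : set (borelV R d * borelV R d)).
  by apply: measurableX => //; exact: measurableC.
(* All samples lie in [Xi], so the second marginal gives its complement no mass; integrals over
   [Xi * setT] can then be cut down to [Xi * Xi]. *)
have Pi0 : Pi (setT `*` ~` Xi) = 0%E.
  rewrite Pi2; last exact: measurableC.
  rewrite /P0 /= /empirical big1 ?mule0// => i _.
  by rewrite diracE memNset//; apply; exact: xih_in.
have mfst : measurable_fun (Xi `*` setT : set (borelV R d * borelV R d))
    (fun z : borelV R d * borelV R d => (f z.1 + M)%:E).
  apply/measurable_EFinP; apply: measurable_funTS; apply: measurable_funD => //.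
  by apply: (measurableT_comp _ measurable_fst); exact: lsc_measurable.
have step1 : (\int[Q]_(xi in Xi) (f xi + M)%:E =
    \int[Pi]_(z in Xi `*` Xi) (f z.1 + M)%:E)%E.
  transitivity (\int[Pi]_(z in Xi `*` setT) (f z.1 + M)%:E)%E.
    have -> : Xi `*` setT = (fst : borelV R d * borelV R d -> _) @^-1` Xi.
      by apply/seteqP; split => [[x y] [? ?]|[x y] ?].
    have := @ge0_integral_pushforward _ _ _ _ R fst measurable_fst Pi Xi
      (fun xi => (f xi + M)%:E) mXi mfM.
    move=> <-; last by move=> y; rewrite inE => Xy; rewrite lee_fin f0.
    apply: eq_measure_integral => S mS _; rewrite /pushforward -Pi1//; congr (Pi _).
    by apply/seteqP; split => [[x y] [? ?]|[x y] ?].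
  rewrite (ge0_negligible_integral mTCX)//; last first.
    by move=> [x y] [/= Xx _]; rewrite lee_fin f0.
  congr integral; apply/seteqP; split => [[x y] [[/= Xx _] ny]|[x y] [/= Xx Xy]].
    by split=> //=; apply: contrapT => nXy; apply: ny.
  by split => // -[_ /=].
have mcost : measurable_fun (Xi `*` Xi : set (borelV R d * borelV R d))
    (fun z : borelV R d * borelV R d => (enorm (z.1 - z.2 : 'cV[R]_d) ^+ 2)%:E).
  apply/measurable_EFinP; apply: measurable_funTS; exact: measurable_sqdist.
have mgsnd D : measurable_fun (D : set (borelV R d * borelV R d))
    (fun z : borelV R d * borelV R d => (g z.2 + M)%:E).
  apply: measurable_funTS; exact: (measurableT_comp mgM measurable_snd).
have step2 : (\int[Pi]_(z in Xi `*` Xi) (f z.1 + M)%:E <=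
  \int[Pi]_(z in Xi `*` Xi) (g z.2 + M)%:E +
    lambda%:E * \int[Pi]_(z in Xi `*` Xi) (enorm (z.1 - z.2) ^+ 2)%:E)%E.
  rewrite -ge0_integralZl//; last by move=> z _; rewrite lee_fin sqr_ge0.
  rewrite -ge0_integralD//; last 3 first.
  - by move=> [x y] [/= _ Xy]; rewrite lee_fin g0.
  - by move=> z _; rewrite -EFinM lee_fin mulr_ge0// sqr_ge0.
  - apply/measurable_EFinP; apply: measurable_funM => //.
    by apply/measurable_EFinP.
  apply: ge0_le_integral => //.
  - by move=> [x y] [/= Xx _]; rewrite lee_fin f0.
  - by apply: measurable_funS mfst => // -[x y] [].
  - apply: emeasurable_funD => //; apply/measurable_EFinP.
    by apply: measurable_funM => //; apply/measurable_EFinP.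
  - move=> [x y] [/= Xx Xy]; rewrite -EFinM -EFinD lee_fin.
    by have := gainE_le y Xx; lra.
(* Enlarging the domain can only increase the integral of a nonnegative function, and on [setT * Xi]
   it becomes an integral against the second marginal. *)
have step3 : (\int[Pi]_(z in Xi `*` Xi) (g z.2 + M)%:E <=
    (N%:R^-1 * \sum_(i < N) beta i + M)%:E)%E.
  apply: (@le_trans _ _ (\int[Pi]_(z in setT `*` Xi) (g z.2 + M)%:E)%E).
    apply: ge0_subset_integral => //.
      by move=> [x y] [/= _ Xy]; rewrite lee_fin g0.
    by move=> [x y] [].
  have -> : (\int[Pi]_(z in setT `*` Xi) (g z.2 + M)%:E =
      \int[P0]_(xi in Xi) (g xi + M)%:E)%E.
    have -> : setT `*` Xi = (snd : borelV R d * borelV R d -> _) @^-1` Xi.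
      by apply/seteqP; split => [[x y] [? ?]|[x y] ?].
    have := @ge0_integral_pushforward _ _ _ _ R snd measurable_snd Pi Xi
      (fun xi => (g xi + M)%:E) mXi (measurable_funTS mgM).
    move=> <-; last by move=> y; rewrite inE => Xy; rewrite lee_fin g0.
    apply: eq_measure_integral => S mS _; rewrite /pushforward -[RHS]Pi2//; congr (Pi _).
    by apply/seteqP; split => [[x y] ?|[x y] [? ?]].
  rewrite (@empirical_integral (fun xi => g xi + M))//.
  by apply/measurable_EFinP; exact: measurable_funTS.
have := le_trans step2 (leeD2r _ step3).
rewrite -step1 integral_shift//.
move: (\int[Q]_(xi in Xi) _)%E (\int[Pi]_(z in _) _)%E => I J.
by rewrite EFinD addeAC leeD2rE.
Qed.

Lemma worst_case_le :
  (worst_case Xi f P0 eps <=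
    (lambda * eps ^+ 2 + N%:R^-1 * \sum_(i < N) beta i)%:E)%E.
Proof.
apply: ge_ereal_sup => _ [Q [[Q1 _] W2Q] <-].
have := @coupling_bound Q; have := integral_shift_fin Q1.
case: (\int[Q]_(xi in Xi) _)%E => // I _ cb.
set a := N%:R^-1 * _ in cb *; rewrite lee_fin.
have [Ia|aI] := leP I a.
  by rewrite (le_trans Ia)// lerDr mulr_ge0// sqr_ge0.
(* A finite distance guarantees that some coupling exists; with [lambda = 0] it would already give
   [I <= a]. *)
have lambda_gt0 : 0 < lambda.
  rewrite lt_neqAle lambda_ge0 andbT; apply/eqP => l0.
  have : (W2 Xi Q P0 < +oo)%E by apply: le_lt_trans W2Q _; rewrite ltry.
  move/ereal_inf_lt => [_ [Pi cPi <-] _].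
  by have := cb Pi Q1 cPi; rewrite -l0 mul0e adde0 lee_fin leNgt aI.
(* No optimal coupling is used: every coupling costs at least [(I - a) / lambda], and this common
   lower bound passes to the infimum. *)
have : (((Num.sqrt ((I - a) / lambda))%:E <= eps%:E)%E).
  apply: le_trans W2Q; apply: le_ereal_inf_tmp => _ [Pi cPi <-].
  rewrite -[X in (X <= _)%E]/(sqrte ((I - a) / lambda)%:E).
  have c0 : (0 <= \int[Pi]_(z in Xi `*` Xi) (enorm (z.1 - z.2) ^+ 2)%:E)%E.
    by apply: integral_ge0 => z _; rewrite lee_fin sqr_ge0.
  rewrite lee_sqrt//; have := cb Pi Q1 cPi.
  move: c0; case: (\int[Pi]_(z in _) _)%E => [c| |]//; last by move=> *; rewrite leey.
  rewrite !lee_fin => _; rewrite ler_pdivrMr//; lra.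
rewrite lee_fin -(ler_pXn2r (n:=2)) ?nnegrE ?sqrtr_ge0 ?(ltW eps_gt0)//.
rewrite sqr_sqrtr ?divr_ge0 ?subr_ge0 ?(ltW aI)// ler_pdivrMr//; lra.
Qed.

End weak.

(** The mixture of the atoms [s i] and [s' i] is coupled to the samples by attaching each atom to
    its own [xih i]. The weights [1 - t] and [t] add up to one at each sample, so the second
    marginal is empirical, and the cost is the one assumed to be at most [eps ^+ 2]. *)
Lemma mixture_le_worst_case (s s' : 'I_N -> 'cV[R]_d) (t : R) :
  (forall i, Xi (s i)) -> (forall i, Xi (s' i)) -> 0 <= t <= 1 ->
  N%:R^-1 * (\sum_(i < N) ((1 - t) * enorm (s i - xih i) ^+ 2 +
                           t * enorm (s' i - xih i) ^+ 2)) <= eps ^+ 2 ->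
  ((N%:R^-1 * \sum_(i < N) ((1 - t) * f (s i) + t * f (s' i)))%:E <=
    worst_case Xi f P0 eps)%E.
Proof.
move=> Xs Xs' t01 cost_le.
have N0 : N%:R != 0 :> R by rewrite pnatr_eq0 -lt0n.
have [Q [QE QI]] := mixture_exists (s : 'I_N -> borelV R d) s' N_gt0 t01.
have [Pi [PiE PiI]] := mixture_exists
  (fun i => (s i, xih i) : borelV R d * borelV R d)
  (fun i => (s' i, xih i)) N_gt0 t01.
have Q1 : Q Xi = 1%E.
  apply: etrans (QE _) _.
  under eq_bigr do rewrite !diracE !mem_set// !mule1 -EFinD subrK.
  by rewrite sumEFin sumr_const card_ord -EFinM mulVf.
have <- : (\int[Q]_(xi in Xi) (f xi)%:E)%E =
    (N%:R^-1 * \sum_(i < N) ((1 - t) * f (s i) + t * f (s' i)))%:E.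
  have := integral_shift Q1; rewrite (QI Xi (fun xi => f xi + M))//; last 2 first.
  - exact: measurable_funD.
  - by move=> z Xz; have := f_bound Xz; rewrite ler_norml => /andP[]; lra.
  have := integral_shift_fin Q1.
  case: (\int[Q]_(xi in Xi) _)%E => // I _ [IM]; congr (_%:E).
  apply: (addIr M); rewrite -IM.
  have -> : \sum_(i < N) ((1 - t) * (f (s i) + M) + t * (f (s' i) + M)) =
      \sum_(i < N) ((1 - t) * f (s i) + t * f (s' i)) + N%:R * M.
    have -> : N%:R * M = \sum_(i < N) M by rewrite sumr_const card_ord mulr_natl.
    rewrite -big_split/=; by apply: eq_bigr => i _; ring.
  by rewrite mulrDr mulKf.
apply: ereal_sup_ubound; exists Q => //; split.
  split=> //; exists (xih (Ordinal N_gt0)) => //.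
  rewrite (QI Xi (fun xi => enorm (xi - xih (Ordinal N_gt0)) ^+ 2)) ?ltry//.
    apply: measurable_funTS; apply: continuous_measurable_cV.
    rewrite (_ : (fun _ => _) = fun z : 'cV[R]_d =>
        dotv (xih (Ordinal N_gt0) - z) (xih (Ordinal N_gt0) - z)).
      by apply: continuous_dotv; apply: continuous_submx => z; exact: cvg_id.
    by apply/funext => z; rewrite enorm_sqr -opprB dotvNl dotvNr opprK.
  by move=> z _; rewrite sqr_ge0.
apply: (@le_trans _ _ (sqrte (eps ^+ 2)%:E)); last first.
  by rewrite /= sqrtr_sqr gtr0_norm.
apply: (@le_trans _ _
    (sqrte (\int[Pi]_(z in Xi `*` Xi) (enorm (z.1 - z.2) ^+ 2)%:E)%E)).
  apply: ereal_inf_lbound; exists Pi => //; split => S mS.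
    apply: etrans (PiE _) _; apply: etrans (esym (QE _)).
    congr (_ * _)%E; apply: eq_bigr => i _; rewrite !diracE.
    by rewrite !in_setX !in_setT !andbT.
  apply: etrans (PiE _) _; congr (_ * _)%E; apply: eq_bigr => i _.
  rewrite !diracE !in_setX !in_setT/= -!EFinM -EFinD; congr (_%:E); ring.
rewrite lee_sqrt ?lee_fin ?sqr_ge0//.
rewrite (PiI _ (fun z : borelV R d * borelV R d => enorm (z.1 - z.2 : 'cV[R]_d) ^+ 2))//.
- exact: measurableX.
- by move=> i; split; [exact: Xs|exact: xih_in].
- by move=> i; split; [exact: Xs'|exact: xih_in].
- by apply: measurable_funTS; exact: measurable_sqdist.
- by move=> z _; rewrite sqr_ge0.
Qed.

(** Strong duality up to [delta]: the one-dimensional multiplier is taken over selections of one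
    point of [Xi] per sample, and the maximization of the Lagrangian then separates over the
    samples. *)
Lemma worst_case_ge (W delta : R) : 0 < delta ->
  worst_case Xi f P0 eps = W%:E ->
  exists lambda beta, [/\ 0 <= lambda,
    forall i xi, Xi xi -> gain lambda xi (xih i) <= beta i &
    lambda * eps ^+ 2 + N%:R^-1 * \sum_(i < N) beta i <= W + delta].
Proof.
move=> delta0 WE; have N0 : 0 < N%:R :> R by rewrite ltr0n.
pose T := {s : 'I_N -> 'cV[R]_d | forall i, Xi (s i)}.
pose c (s : T) := N%:R^-1 * \sum_(i < N) enorm (sval s i - xih i) ^+ 2.
pose w (s : T) := N%:R^-1 * \sum_(i < N) f (sval s i).
pose s0 : T := exist _ xih xih_in.
(* Leaving every sample in place costs [0 < eps ^+ 2], which is the Slater condition. *)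
have [||lambda lambda0 lagr] := @lagrange_multiplier R T c w (eps ^+ 2) W s0.
- rewrite /c big1 => [|i _]; first by rewrite mulr0 exprn_gt0.
  by rewrite subrr enorm_sqr dotv0r.
- move=> s s' t t01; rewrite /c /w.
  rewrite ![(1 - t) * (_ * _)]mulrCA ![t * (_ * _)]mulrCA -!mulrDr !mulr_sumr.
  rewrite -!big_split/= => cle.
  rewrite -lee_fin -WE; apply: mixture_le_worst_case => // i.
  - exact: svalP s i.
  - exact: svalP s' i.
pose beta i := sup [set gain lambda xi (xih i) | xi in Xi].
exists lambda, beta; split => //.
  move=> i xi Xxi; apply: ub_le_sup; first exact: gain_has_ubound.
  by exists xi.
(* The suprema [beta i] are approached within [delta] by one selection; averaging the [N] errors
   loses [delta] in total. *)
have /choice [s hs] : forall i, exists xi, Xi xi /\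
    beta i - delta < gain lambda xi (xih i).
  move=> i; have [] := @sup_adherent R [set gain lambda xi (xih i) | xi in Xi] delta.
  - exact: delta0.
  - split; last exact: gain_has_ubound.
    by exists (gain lambda (xih i) (xih i)), (xih i).
  by move=> _ [xi Xxi <-] h; exists xi.
have := lagr (exist _ s (fun i => (hs i).1)); rewrite /c /w/=.
have : N%:R^-1 * \sum_(i < N) (beta i - delta) <=
    N%:R^-1 * \sum_(i < N) gain lambda (s i) (xih i).
  rewrite ler_wpM2l ?invr_ge0 ?(ltW N0)// ler_sum// => i _; exact: ltW (hs i).2.
rewrite /gain !sumrB -mulr_sumr sumr_const card_ord -[delta *+ N]mulr_natl.
under [X in _ - lambda * X]eq_bigr do rewrite -enorm_sqr.
rewrite !mulrBr mulKf ?gt_eqF//.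
rewrite [N%:R^-1 * (lambda * _)]mulrCA; lra.
Qed.

End wasserstein_duality.

(** * The optimal value function and the theorem *)

Section opt_value.
Variables (R : realType) (k n : nat) (F : 'M[R]_(n, k.+1)).
Variables (X : set 'cV[R]_n) (r : R).
Hypothesis X_nonempty : X !=set0.
Hypothesis X_le : forall x, X x -> dotv x x <= r.

Lemma dotv_le_AMGM d (x y : 'cV[R]_d) :
  `|dotv x y| <= (dotv x x + dotv y y) / 2.
Proof.
rewrite ler_norml; have := dotv_ge0 (x - y); have := dotv_ge0 (x + y).
rewrite !dotvDl !dotvDr !dotvNl !dotvNr [dotv y x]dotvC => h1 h2.
by apply/andP; split; lra.
Qed.

Lemma opt_value_has_ubound xi : has_ubound [set dotv (F *m xi) x | x in X].
Proof.
exists ((dotv (F *m xi) (F *m xi) + r) / 2) => _ [x Xx <-].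
apply: le_trans (ler_norm _) (le_trans (dotv_le_AMGM _ _) _).
by have := X_le Xx; lra.
Qed.

Lemma opt_value_lsc a : open [set xi | a < opt_value F X xi].
Proof.
rewrite /opt_value; apply: (@open_sup_gt R _ _ X (fun x xi => dotv (F *m xi) x)).
- exact: X_nonempty.
- move=> x; apply: continuous_dotv; last exact: cst_continuous.
  by apply: continuous_mulmx => z; exact: cvg_id.
- exact: opt_value_has_ubound.
Qed.

Lemma opt_value_norm_le xi :
  `|opt_value F X xi| <= (dotv (F *m xi) (F *m xi) + r) / 2.
Proof.
have [x0 Xx0] := X_nonempty; rewrite ler_norml; apply/andP; split.
  apply: (@le_trans _ _ (dotv (F *m xi) x0)); last first.
    by apply: ub_le_sup; [exact: opt_value_has_ubound|exists x0].
  have := dotv_le_AMGM (F *m xi) x0; rewrite ler_norml => /andP[+ _].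
  by have := X_le Xx0; lra.
apply: ge_sup; first by exists (dotv (F *m xi) x0), x0.
move=> _ [x Xx <-]; apply: le_trans (ler_norm _) (le_trans (dotv_le_AMGM _ _) _).
by have := X_le Xx; lra.
Qed.

End opt_value.

Theorem mainTheorem1 (R : realType) (m n k N : nat)
  (A : 'M[R]_(m, n)) (F : 'M[R]_(n, k.+1)) (b : 'cV[R]_m) (B : {set 'I_n})
  (Xihat : set 'cV[R]_k.+1)
  (Xihat_first : forall xi, Xihat xi -> 0 <= xi 0 0)
  (Xihat_closed : closed Xihat)
  (Xihat_convex : convex_set Xihat)
  (Xihat_full : full_dimensional Xihat)
  (Xihat_cone : is_cone Xihat)
  (Xi_nonempty : slice Xihat !=set0)
  (X_nonempty : feasible_set A b B !=set0)
  (X_bounded : bounded_set (feasible_set A b B))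
  (relax01 : forall x, relaxation A b x ->
     forall j, j \in B -> 0 <= x j 0 <= 1)
  (Xi_convex : convex_set (slice Xihat))
  (Xi_closed : closed (slice Xihat))
  (Xi_bounded : bounded_set (slice Xihat))
  (N_gt0 : (0 < N)%N)
  (dO : measure_display) (Omega : measurableType dO)
  (Pr : probability Omega R)
  (P : probability (borelV R k.+1) R)
  (P_supp : supported_on (slice Xihat) P)
  (X : 'I_N -> {RV Pr >-> borelV R k.+1})
  (X_law : forall i (S : set (borelV R k.+1)),
     measurable S -> distribution Pr (X i) S = P S)
  (X_indep : mutually_independent X)
  (omega : Omega)
  (X_in_Xi : forall i, slice Xihat (X i omega))
  (eps : R) (eps_gt0 : 0 < eps)
  (r : R) (r_gt0 : 0 < r)
  (r_bound : forall xi x, slice Xihat xi -> feasible_set A b B x ->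
     dotv xi xi + dotv x x <= r) :
  worst_case (slice Xihat) (opt_value F (feasible_set A b B))
    (empirical (fun i => X i omega)) eps
  = cop_value A b F B Xihat (fun i => X i omega) r eps.
Proof.
set xih := fun i => X i omega.
have [xi0 Xi0] := Xi_nonempty; have [x0 X0] := X_nonempty.
have X_le x : feasible_set A b B x -> dotv x x <= r.
  by move=> Xx; have := r_bound _ _ Xi0 Xx; have := dotv_ge0 xi0; lra.
(* The estimate of the optimal value is quadratic in [F xi], hence bounded on the compact slice. *)
have [M f_bound] : exists M, forall xi, slice Xihat xi ->
    `|opt_value F (feasible_set A b B) xi| <= M.
  have cF : continuous (fun xi : 'cV[R]_k.+1 => dotv (F *m xi) (F *m xi)).
    by apply: continuous_dotv; apply: continuous_mulmx => z; exact: cvg_id.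
  have [||c _ Fmax] := @compact_EVT_max _ R
      (fun xi : 'cV[R]_k.+1 => dotv (F *m xi) (F *m xi)) _ Xi_nonempty.
  - exact: cV_bounded_closed_compact.
  - exact: continuous_subspaceT.
  exists ((dotv (F *m c) (F *m c) + r) / 2) => xi Xxi.
  apply: le_trans (opt_value_norm_le F X_nonempty X_le xi) _.
  by have := Fmax xi (mem_set Xxi); lra.
have f_lsc := opt_value_lsc (F := F) X_nonempty X_le.
apply/eqP; rewrite eq_le; apply/andP; split.
  apply: le_ereal_inf_tmp => _ [lambda [alpha [rho [u [v [[cop rho0 lambda0] ->]]]]]].
  (* Weak duality is used with [beta i = alpha i + r * rho i], as read off the objective. *)
  apply: (worst_case_le N_gt0 Xi_closed f_lsc f_bound X_in_Xi eps_gt0 lambda0).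
  move=> i xi Xxi; rewrite lerBlDr; apply: ge_sup.
    by exists (dotv (F *m xi) x0), x0.
  move=> _ [x Xx <-]; have [[Ax x_ge0] xB] := Xx; have [Kxi xi1] := Xxi.
  have Kz : lifted_cone Xihat (col_mx xi x).
    by split; rewrite ?col_mxKu ?col_mxKd.
  have [_ /(_ _ Kz)] := cop i.
  rewrite -/(cop_matrix A F b (xih i) lambda (alpha i) (rho i) (u i) (v i)).
  rewrite dotv_cop_matrix xi1 !scale1r Ax subrr expr1n mulr1.
  rewrite big1 => [|l _]; last by rewrite mxE expr0n mulr0.
  rewrite big1 => [|j _]; last by have [->|->] := xB _ (valP j); ring.
  have := ler_wpM2l (rho0 i) (r_bound _ _ Xxi Xx).
  by rewrite /xih; lra.
(* The value [+oo] is trivial, and [-oo] is excluded by the mixture that keeps every sample in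
   place. *)
case WE : (worst_case _ _ _ _) => [W| |]; last 2 first.
- exact: leey.
- have t01 : 0 <= (0 : R) <= 1 by rewrite lexx ler01.
  have := mixture_le_worst_case N_gt0 Xi_closed f_lsc f_bound X_in_Xi eps_gt0
    X_in_Xi X_in_Xi t01.
  rewrite WE big1 => [|i _]; last by rewrite subrr enorm_sqr dotv0r !mulr0 addr0.
  by rewrite mulr0 sqr_ge0 => /(_ isT).
apply/lee_addgt0Pr => e e0.
have e2 : 0 < e / 2 by lra.
have [lambda [beta [lambda0 beta_ub obj]]] :=
  worst_case_ge N_gt0 Xi_closed f_lsc f_bound X_in_Xi eps_gt0 e2 WE.
(* Half of the tolerance [e] pays for the duality gap; with this [rho] the term [r * rho] is the
   other half. *)
have rho0 : 0 < e / 2 / r by rewrite divr_gt0.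
have cert i : exists uv : 'cV[R]_m * ({j | j \in B} -> R),
    COP (lifted_cone Xihat)
      (cop_matrix A F b (xih i) lambda (beta i) (e / 2 / r) uv.1 uv.2).
  have [|u [v uv]] := cop_certificate Xihat_first Xihat_closed Xihat_convex
    Xihat_cone Xi_nonempty X_nonempty X_bounded relax01 Xi_bounded
    (F := F) (xih := xih i) (lambda := lambda) (beta := beta i) rho0.
    move=> xi x Xxi Xx; apply: le_trans (beta_ub i xi Xxi).
    rewrite lerD2r; apply: ub_le_sup; last by exists x.
    exact: opt_value_has_ubound X_le xi.
  by exists (u, v).
have /choice [uv uvP] := cert.
apply: (@le_trans _ _ (cop_objective r eps lambda beta (fun=> e / 2 / r))%:E).
  apply: ereal_inf_lbound; exists lambda, beta, (fun=> e / 2 / r).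
  exists (fun i => (uv i).1), (fun i => (uv i).2); split=> //; split=> // i.
  exact: ltW.
rewrite -EFinD lee_fin /cop_objective big_split/= sumr_const card_ord.
rewrite [r * _]mulrC divfK ?gt_eqF// -[(e / 2) *+ N]mulr_natl mulrDr mulKf.
  by lra.
by rewrite pnatr_eq0 -lt0n.
Qed.
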